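(* For a positive integer $m$, let the minimum below range over all graphs $G$ with exactly $m$ edges. Then $$\lim_{m\to\infty}\ \min_{\substack{G\\ |E(G)|=m}} \frac{\alpha_1(G)+\tau_1(G)}{m^{2/3}}=\frac{3}{2}.$$
   Context: All graphs are simple and undirected; $E(G)$ denotes the edge set of $G$. A triangle is a clique on three vertices. For a graph $G$, $\alpha_1(G)$ (the triangle-independence number) is the maximum size of a set of edges of $G$ that contains at most one edge from each triangle of $G$. $\tau_1(G)$ (the triangle edge cover number) is the minimum size of a set of edges of $G$ that contains at least one edge from each triangle of $G$; equivalently, it is the minimum number of edges whose removal makes $G$ triangle-free. *)

(* Defs.v *)
From HB Require Import structures.
From mathcomp Require Import all_boot all_order all_algebra.
From mathcomp Require Import all_classical all_reals all_analysis.

Set Implicit Arguments.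
Unset Strict Implicit.
Unset Printing Implicit Defensive.

Import Order.TTheory GRing.Theory Num.Theory.

Record sgraph := SGraph {
  vertex : finType;
  adj : rel vertex;
  adj_sym : symmetric adj;
  adj_irrefl : irreflexive adj }.

Section GraphParameters.
Variable G : sgraph.
Local Notation V := (vertex G).
Local Open Scope set_scope.

Definition edges : {set {set V}} :=
  [set e : {set V} | [exists x, exists y, adj x y && (e == [set x; y])]].

Definition is_clique (K : {set V}) : bool :=
  [forall x in K, forall y in K, (x != y) ==> adj x y].

Definition triangle (K : {set V}) : bool := (#|K| == 3) && is_clique K.

(* For a triangle [K], the members of [A] contained in [K] are exactly the
   edges of [K] that belong to [A], as long as [A \subset edges]. *)
Definition edges_in (A : {set {set V}}) (K : {set V}) : {set {set V}} :=
  [set e in A | e \subset K].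

Definition triangle_independent (A : {set {set V}}) : bool :=
  (A \subset edges) && [forall K, triangle K ==> (#|edges_in A K| <= 1)].

Definition triangle_cover (A : {set {set V}}) : bool :=
  (A \subset edges) && [forall K, triangle K ==> (1 <= #|edges_in A K|)].

Definition alpha1 : nat :=
  \max_(A : {set {set V}} | triangle_independent A) #|A|.

(* [edges] is itself a cover (lemma [triangle_cover_edges]), so this is a
   genuine minimum. *)
Definition tau1 : nat :=
  #|[arg min_(A < edges | triangle_cover A) #|A|]|.

Lemma triangle_cover_edges : triangle_cover edges.
Proof.
apply/andP; split=> //; apply/forallP => K; apply/implyP => /andP[/eqP K3 clK].
have /card_gt1P[x [y [xK yK xy]]] : 1 < #|K| by rewrite K3.
apply/card_gt0P; exists [set x; y]; rewrite !inE; apply/andP; split.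
  apply/existsP; exists x; apply/existsP; exists y; rewrite eqxx andbT.
  by move/forall_inP: clK => /(_ x xK)/forall_inP/(_ y yK)/implyP; apply.
by apply/fintype.subsetP => z; rewrite !inE => /orP[]/eqP->.
Qed.

Lemma tau1P :
  (exists2 A, triangle_cover A & #|A| = tau1) /\
  (forall A, triangle_cover A -> tau1 <= #|A|).
Proof.
rewrite /tau1; case: arg_minnP; first exact: triangle_cover_edges.
by move=> A cA minA; split => //; exists A.
Qed.

End GraphParameters.

Section Star.
Variable m : nat.
Local Open Scope set_scope.

Definition star_adj : rel 'I_m.+1 := fun x y => (x == ord0) (+) (y == ord0).

Lemma star_adj_sym : symmetric star_adj.
Proof. by move=> x y; rewrite /star_adj addbC. Qed.

Lemma star_adj_irrefl : irreflexive star_adj.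
Proof. by move=> x; rewrite /star_adj addbb. Qed.

Definition star : sgraph := SGraph star_adj_sym star_adj_irrefl.

Lemma card_edges_star : #|edges star| = m.
Proof.
pose f (i : 'I_m) : {set 'I_m.+1} := [set ord0; lift ord0 i].
have -> : edges star = f @: [set: 'I_m].
  apply/setP => e; rewrite inE; apply/existsP/imsetP => [[x /existsP[y]]|[i _ ->]].
    rewrite /= /star_adj => /andP[xy /eqP->].
    case: (unliftP ord0 x) xy => [i ->|->]; case: (unliftP ord0 y) => [j ->|->];
      rewrite ?eqxx //= => _.
    - by exists i; [exact: finset.in_setT | exact: finset.setUC].
    - by exists j; first exact: finset.in_setT.
  exists ord0; apply/existsP; exists (lift ord0 i).
  by rewrite /= /star_adj !eqxx.
rewrite card_imset ?cardsT ?card_ord // => i j /setP/(_ (lift ord0 i)).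
by rewrite !inE eqxx /= => /esym/eqP/lift_inj.
Qed.

End Star.

Local Open Scope ring_scope.

Definition ratio (R : realType) (G : sgraph) (m : nat) : R :=
  (alpha1 G + tau1 G)%N%:R / m%:R `^ (2 / 3).

Definition ratios (R : realType) (m : nat) : set R :=
  fun r => exists G : sgraph, #|edges G| = m /\ r = ratio R G m.

Lemma ratios_has_min (R : realType) (m : nat) :
  exists r, ratios m r /\ lbound (@ratios R m) r.
Proof.
pose P k := `[< exists G, #|edges G| = m /\ (alpha1 G + tau1 G)%N = k >].
have exP : exists k, P k.
  exists (alpha1 (star m) + tau1 (star m))%N; apply/asboolP.
  by exists (star m); rewrite card_edges_star.
case: (ex_minnP exP) => k /asboolP[G [Gm Gk]] kmin.
exists (ratio R G m); split; first by exists G.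
move=> _ [H [Hm ->]]; rewrite /ratio ler_wpM2r ?invr_ge0 ?powR_ge0 //.
by rewrite ler_nat Gk; apply: kmin; apply/asboolP; exists H.
Qed.

Definition min_ratio (R : realType) (m : nat) : R :=
  projT1 (cid (ratios_has_min R m)).

Lemma min_ratioP (R : realType) (m : nat) :
  ratios m (min_ratio R m) /\ lbound (ratios m) (min_ratio R m).
Proof. exact: projT2 (cid (ratios_has_min R m)). Qed.

(* Main.v *)
Require Import Defs.
From HB Require Import structures.
From mathcomp Require Import all_boot all_order all_algebra.
From mathcomp Require Import all_classical all_reals all_analysis.
From mathcomp Require Import zify ring lra.
Set Implicit Arguments.
Unset Strict Implicit.
Import Order.TTheory GRing.Theory Num.Theory.
Import numFieldNormedType.Exports.

(** Write x for the cube root of m, so that m^(2/3) = x^2. The ratio is shown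
    to be within 5/x of 3/2 for the best graph with m edges.

    Lower bound. Let T be a minimum triangle edge cover of G, with t edges, and
    colour the vertices properly with respect to T using as few colours, say k,
    as possible. Some edge of T joins any two colour classes, as otherwise they
    could be merged, so 'C(k, 2) <= t ([exists_minimal_colouring]). Now give
    each edge uv outside T the sum modulo k of the colours of u and v. If two
    such edges uv and uw lie in a triangle, then vw is in T because T meets the
    triangle, so v and w have different colours and the two sums differ. Hence
    each of the k values defines a triangle-independent set, and
    m - t <= k * alpha1 ([card_edges_le_colouring]). Thus alpha1 + tau1 is at
    least (m - t) / k + t, which is at least about x^3 / k + k^2 / 2, and by the
    inequality between arithmetic and geometric means this is at least
    (3/2) x^2 up to a term linear in x.

    Upper bound. Equality suggests k close to x: join a clique on k vertices
    completely to about m / k independent vertices. Deleting the clique edges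
    destroys all triangles, so tau1 <= 'C(k, 2). Two edges with a common larger
    endpoint (clique vertices being the smallest) always lie in a triangle, so
    alpha1 is at most the number of vertices. One vertex of lower degree gives
    exactly m edges ([exists_small_graph]). *)

(** * Proper colourings and pairs inside a three-element set *)

Section Colouring.
Variable V : finType.
Local Open Scope set_scope.
Implicit Types (T : {set {set V}}) (e K : {set V}).

Definition proper_colouring (C : finType) T (c : V -> C) :=
  forall e, e \in T -> {in e &, injective c}.

(** In a proper colouring with the fewest colours every pair of colours is
    realised by a member of [T], since two classes joined by no member could be
    merged; distinct pairs of colours need distinct members. *)
Lemma exists_minimal_colouring T :
  {in T, forall e, #|e| = 2} ->
  exists k (c : V -> 'I_k), proper_colouring T c /\ 'C(k, 2) <= #|T|.
Proof.
move=> T2.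
pose P k := `[< exists c : V -> 'I_k, proper_colouring T c >].
have exP : exists k, P k.
  by exists #|V|; apply/asboolP; exists enum_rank => e _ x y _ _ /enum_rank_inj.
case: (ex_minnP exP) => k /asboolP[c cT] kmin; exists k, c; split => //.
rewrite -[k in 'C(k, _)]card_ord -card_draws.
apply: leq_trans (leq_imset_card (fun e : {set V} => c @: e) T).
apply: subset_leq_card; apply/fintype.subsetP => A; rewrite inE => A2.
apply: contraT => nA; have /cards2P[i [j [ij AE]]] := A2.
case: k => [|k] in c cT kmin A A2 nA i j ij AE *; first by case: (i).
(* Recolour class [j] with the colour [i]; the result avoids [j], so [unlift]
   turns it into a colouring with one colour less. *)
suff /kmin : P k by rewrite ltnn.
have [i' ii'|iE] := unliftP j i; last by rewrite iE eqxx in ij.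
apply/asboolP; exists (fun x => odflt i' (unlift j (c x))) => e eT x y xe ye.
have nij a b : a \in e -> b \in e -> c a = i -> c b <> j.
  move=> ae be ca cb; move/negP: nA; apply; apply/imsetP; exists e => //.
  apply/eqP; rewrite eqEcard AE (leq_trans (leq_imset_card c e)) ?T2 ?cards2 ?ij // andbT.
  by apply/fintype.subsetP => z; rewrite !inE => /orP[]/eqP->; rewrite -?ca -?cb imset_f.
case: unliftP => [a ca|ca]; case: unliftP => [b cb|cb] /= ab.
- by apply: (cT e) => //; rewrite ca cb ab.
- by case: (nij x y) => //; rewrite ca ab ii'.
- by case: (nij y x) => //; rewrite cb -ab ii'.
- by apply: (cT e) => //; rewrite ca cb.
Qed.

(** Naming an edge of a triangle by the opposite vertex lets three edges of one
    triangle be compared without any case analysis on their endpoints. *)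
Lemma triangle_edgeP K e :
  #|K| = 3 -> #|e| = 2 -> e \subset K -> exists2 x, x \in K & e = K :\ x.
Proof.
move=> K3 e2 eK.
have /cards1P[x xE] : #|K :\: e| == 1 by rewrite cardsD (finset.setIidPr eK) K3 e2.
exists x; first by have := finset.set11 x; rewrite -xE inE => /andP[].
by rewrite -xE finset.setDDr finset.setDv finset.set0U (finset.setIidPr eK).
Qed.

End Colouring.

(** * The lower bound *)

Section LowerBound.
Variable G : sgraph.
Local Notation V := (vertex G).
Local Open Scope set_scope.
Implicit Types (A T : {set {set V}}) (K e : {set V}).

Lemma edgeP e :
  reflect (exists x y, adj x y /\ e = [set x; y]) (e \in edges G).
Proof.
rewrite inE; apply: (iffP existsP) => [[x /existsP[y /andP[xy /eqP ->]]]|].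
  by exists x, y.
by move=> [x [y [xy ->]]]; exists x; apply/existsP; exists y; rewrite xy /=.
Qed.

Lemma adj_neq (x y : V) : adj x y -> x != y.
Proof. by apply: contraTneq => ->; rewrite adj_irrefl. Qed.

Lemma card_edge e : e \in edges G -> #|e| = 2.
Proof. by move=> /edgeP[x [y [/adj_neq xy ->]]]; rewrite cards2 xy. Qed.

Lemma alpha1_ge A : triangle_independent A -> #|A| <= alpha1 G.
Proof. by move=> indA; apply: (bigop.bigmax_sup A). Qed.

(** The edges outside [T] are sorted by the sum modulo [k.+1] of the colours of
    their endpoints. Two edges of a triangle with the same sum have opposite
    vertices of equal colour; these two vertices span the third edge, which is
    in [T] as [T] meets the triangle, so they coincide. *)
Lemma card_edges_le_colouring T k (c : V -> 'I_k.+1) :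
  triangle_cover T -> proper_colouring T c ->
  #|edges G| <= alpha1 G * k.+1 + #|T|.
Proof.
move=> /andP[TE /forallP Tcov] cT.
pose s e : 'I_k.+1 := inord ((\sum_(x in e) c x) %% k.+1).
pose F j := [set e in edges G :\: T | s e == j].
have indF j : triangle_independent (F j).
  apply/andP; split.
    by apply/fintype.subsetP => e; rewrite !inE -andbA => /and3P[].
  apply/forallP => K; apply/implyP => triK.
  have K3 : #|K| = 3 by case/andP: triK => /eqP.
  have FE h : h \in F j -> [/\ h \in edges G, h \notin T & s h = j].
    by rewrite finset.in_set finset.in_setD => /andP[/andP[? ?] /eqP].
  apply/card_le1_eqP => e f; rewrite finset.in_set => /andP[/FE[eE eT se] eK].
  rewrite finset.in_set => /andP[/FE[fE fT sf] fK].
  have /card_gt0P[g] := implyP (Tcov K) triK; rewrite finset.in_set => /andP[gT gK].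
  have edge3 h : h \in edges G -> h \subset K -> exists2 x, x \in K & h = K :\ x.
    by move=> /card_edge h2; apply: triangle_edgeP.
  have gE := fintype.subsetP TE g gT.
  have [a aK ea] : exists2 x, x \in K & e = K :\ x by apply: edge3.
  have [b bK fb] : exists2 x, x \in K & f = K :\ x by apply: edge3.
  have [d dK gd] := edge3 _ gE gK.
  (* [e] and [f] are opposite [a] and [b]; the edge [g] of [T] is a third one,
     hence contains both. *)
  have ag : a \in g by rewrite gd !inE aK andbT; apply: contraNneq eT => ad; rewrite ea ad -gd.
  have bg : b \in g by rewrite gd !inE bK andbT; apply: contraNneq fT => bd; rewrite fb bd -gd.
  rewrite ea fb; congr (_ :\ _); apply: (cT g) => //; apply/val_inj => /=.
  (* The colour sum of an edge and the colour of its opposite vertex add up to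
     the same total over the triangle. *)
  have sE x : x \in K -> \sum_(y in K) c y = c x + \sum_(y in K :\ x) c y.
    by move=> xK; rewrite (big_setD1 x).
  have : s e = s f by rewrite se sf.
  move=> /(congr1 val); rewrite /s /= !inordK ?ltn_mod // => /eqP sef.
  have : c a + \sum_(y in e) c y = c b + \sum_(y in f) c y.
    by rewrite ea fb -!sE.
  move: sef; rewrite -(eqn_modDl (c a)) => /eqP + E; rewrite E => /eqP.
  by rewrite eqn_modDr !modn_small ?ltn_ord // => /eqP.
rewrite -(cardsID T) finset.setIC [X in _ <= X]addnC leq_add //.
  by rewrite subset_leq_card // finset.subsetIl.
rewrite -sum1_card (partition_big s xpredT) //=.
apply: (leq_trans (n := \sum_(j < k.+1) alpha1 G)).
  apply: leq_sum => j _; apply: leq_trans (alpha1_ge (indF j)).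
  by rewrite sum1dep_card.
by rewrite sum_nat_const card_ord mulnC.
Qed.

(** Here [k] is the number of colours and [t] is [tau1 G]. The inequality is
    m - t <= k * alpha1 with [t * k] added to both sides, which removes the
    truncated subtraction and leaves only the sum of the two parameters. *)
Lemma alpha1_tau1_ge : 0 < #|edges G| ->
  exists k t, [/\ 0 < k, 'C(k, 2) <= t &
    #|edges G| + t * k <= (alpha1 G + tau1 G) * k + t].
Proof.
move=> E0; have [[T Tcov TE] _] := tau1P G.
have T2 : {in T, forall e, #|e| = 2}.
  by move=> e eT; apply: card_edge; case/andP: Tcov => /fintype.subsetP/(_ e eT).
have [k [c [cT kT]]] := exists_minimal_colouring T2.
case: k => [|k] in c cT kT *.
  by case/card_gt0P: E0 => e /edgeP[x _]; case: (c x).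
exists k.+1, #|T|; split => //; rewrite -TE mulnDl addnAC leq_add2r.
exact: (card_edges_le_colouring Tcov cT).
Qed.
End LowerBound.

(** * Graphs attaining the bound *)

Section Construction.
Variables (n k : nat) (d : nat -> nat).
Hypothesis d_le_id : forall j, d j <= j.
Hypothesis d_le_k : forall j, d j <= k.
Hypothesis d_id : forall j, j < k -> d j = j.
Local Open Scope set_scope.

(** Vertex [j] is joined to the first [d j] vertices, all of which precede it.
    With [d j] equal to [j] for [j < k] and at most [k] elsewhere, the first [k]
    vertices form a clique and the others are pairwise non-adjacent. Encoding
    the graph by [d] makes its number of edges a sum that is easy to adjust. *)
Definition back_adj : rel 'I_n := fun i j => (i < d j) || (j < d i).

Lemma back_adj_sym : symmetric back_adj.
Proof. by move=> i j; rewrite /back_adj orbC. Qed.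

Lemma back_adj_irrefl : irreflexive back_adj.
Proof. by move=> i; rewrite /back_adj orbb ltnNge d_le_id. Qed.

Definition back_graph : sgraph := SGraph back_adj_sym back_adj_irrefl.

Lemma back_edgeP (e : {set 'I_n}) : reflect (exists i j : 'I_n, i < d j /\ e = [set i; j])
  (e \in edges back_graph).
Proof.
apply: (iffP (edgeP _)) => [[i [j [/= ij eE]]]|[i [j [ij ->]]]]; last first.
  by exists i, j; split; rewrite //= /back_adj ij.
case/orP: ij => ij; first by exists i, j.
by exists j, i; rewrite finset.setUC.
Qed.

Lemma card_back_edges : #|edges back_graph| = \sum_(j < n) d j.
Proof.
pose P := [set p : 'I_n * 'I_n | p.1 < d p.2].
have -> : edges back_graph = (fun p : 'I_n * 'I_n => [set p.1; p.2]) @: P.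
  apply/setP => e; apply/back_edgeP/imsetP => [[i [j [ij ->]]]|[[i j]]].
    by exists (i, j); rewrite ?inE.
  by rewrite inE => /= ij ->; exists i, j.
rewrite card_in_imset => [|[i j] [i' j']]; last first.
  rewrite !inE /= => ij ij' E.
  have dj := d_le_id j; have dj' := d_le_id j'.
  have := finset.set21 i j; have := finset.set22 i j; rewrite E !inE.
  case/orP=> /eqP jE; case/orP=> /eqP iE; subst i j; rewrite //; lia.
rewrite -sum1dep_card.
rewrite (eq_bigl (fun p : 'I_n * 'I_n => xpredT p.2 && (p.1 < d p.2))) //.
transitivity (\sum_(j < n) \sum_(i < n | i < d j) 1).
  by rewrite (exchange_big_dep xpredT) //= pair_big_dep.
apply: eq_bigr => j _; have jn : d j <= n by rewrite (leq_trans (d_le_id j)) // ltnW.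
by rewrite (big_ord_narrow jn) /= sum1_card card_ord.
Qed.

(** Two edges with the same larger endpoint [j] have their smaller endpoints in
    the clique, hence lie in a common triangle; so a triangle-independent set
    injects into the vertices by taking larger endpoints. *)
Lemma alpha1_back_graph : alpha1 back_graph <= n.
Proof.
apply/bigmax_leqP => A /andP[/fintype.subsetP AE /forallP indA].
have [->|[e0 e0A]] := set_0Vmem A; first by rewrite finset.cards0.
have n0 : 0 < n.
  by have /back_edgeP[i _] := AE e0 e0A; apply: leq_ltn_trans (ltn_ord i).
(* The remainder only serves to make [top] total: the maximum is below [n]. *)
pose top (e : {set 'I_n}) := Ordinal (ltn_pmod (\max_(x in e) (x : nat)) n0).
have topE (i j : 'I_n) : i < j -> top [set i; j] = j.
  move=> ij; apply/val_inj; rewrite /= big_setU1 ?big_set1 /=; last first.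
    by rewrite inE neq_ltn ij.
  by rewrite (maxn_idPr (ltnW ij)) modn_small.
rewrite -[leqRHS]card_ord -(card_in_imset (f := top) (D := A)) ?max_card //.
move=> e e' eA e'A; have /back_edgeP[i [j [ij eE]]] := AE e eA.
have /back_edgeP[i' [j' [ij' eE']]] := AE e' e'A; subst e e'.
have dj := d_le_id j; have dj' := d_le_id j'.
rewrite !topE; try lia; move=> jj; subst j'.
have [->//|ii] := eqVneq i i'.
have di : d i = i by apply: d_id; have := d_le_k j; lia.
have di' : d i' = i' by apply: d_id; have := d_le_k j; lia.
have ii2 : (i : nat) != i' by [].
pose S := [set j; i; i'].
have triS : triangle (G := back_graph) S.
  apply/andP; split.
    have ji : (j : nat) != i by lia.
    have ji' : (j : nat) != i' by lia.
    by rewrite /S finset.setUC finset.cardsU1 cards2 !inE negb_or !(eq_sym i') ii ji ji'.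
  apply/forall_inP => x; rewrite !inE => xS; apply/forall_inP => y; rewrite !inE => yS.
  apply/implyP; rewrite -(inj_eq val_inj) /= /back_adj.
  by case/orP: xS => [/orP[]|] /eqP ->; case/orP: yS => [/orP[]|] /eqP -> /=;
    rewrite ?di ?di'; lia.
have /card_le1_eqP := implyP (indA S) triS; apply; rewrite inE ?eA ?e'A /=.
  by apply/fintype.subsetP => x; rewrite !inE => /orP[]->; rewrite ?orbT.
by apply/fintype.subsetP => x; rewrite !inE => /orP[]->; rewrite ?orbT.
Qed.

(** The clique edges form a cover: a triangle has at most one vertex outside the
    clique. *)
Lemma tau1_back_graph : tau1 back_graph <= 'C(k, 2).
Proof.
pose K := [set i : 'I_n | i < k].
pose T := [set e in edges back_graph | e \subset K].
have [_ /(_ T) tauT] := tau1P back_graph; apply: leq_trans (tauT _) _.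
  apply/andP; split.
    by apply/fintype.subsetP => e; rewrite inE => /andP[].
  apply/forallP => S; apply/implyP => /andP[/eqP S3 /forall_inP clS].
  have SK : #|S :\: K| <= 1.
    apply/card_le1_eqP => x y; rewrite !inE -!leqNgt => /andP[xK xS] /andP[yK yS].
    apply/eqP; rewrite eq_sym; apply: contraT => xy.
    have := implyP (forall_inP (clS _ xS) _ yS) xy; rewrite /= /back_adj.
    by have := d_le_k x; have := d_le_k y; lia.
  have /card_gt1P[x [y [xSK ySK xy]]] : 1 < #|S :&: K|.
    by rewrite ltnNge; apply/negP => SK1; have := leq_add SK1 SK; rewrite cardsID S3.
  apply/card_gt0P; exists [set x; y]; rewrite !inE.
  move: xSK ySK; rewrite !inE => /andP[xS xK] /andP[yS yK].
  apply/andP; split; last by apply/fintype.subsetP => z; rewrite !inE => /orP[]/eqP->.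
  apply/andP; split; last by apply/fintype.subsetP => z; rewrite !inE => /orP[]/eqP->.
  apply/existsP; exists x; apply/existsP; exists y; rewrite eqxx andbT.
  exact: implyP (forall_inP (clS _ xS) _ yS) xy.
have Kk : #|K| <= k.
  have [nk|/ltnW kn] := leqP n k.
    by apply: leq_trans nk; rewrite -[leqRHS]card_ord max_card.
  by rewrite -sum1dep_card (big_ord_narrow kn) sum1_card card_ord.
apply: leq_trans (_ : 'C(#|K|, 2) <= _); last exact: leq_bin2l.
rewrite -cards_draws; apply: subset_leq_card; apply/fintype.subsetP => e.
by rewrite !inE => /andP[eE ->]; rewrite (@card_edge back_graph) ?inE.
Qed.
End Construction.

Lemma two_bin2 k : 2 * 'C(k, 2) = k * k.-1.
Proof. by rewrite -mul_bin_diag bin1. Qed.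

(** A clique on [k] vertices, [N] vertices joined to all of it, and a last vertex
    joined to [r] of its vertices, where [N] and [r] are the quotient and the
    remainder of [m - 'C(k, 2)] by [k]. *)
Lemma exists_small_graph m k : 0 < k -> 'C(k, 2) <= m ->
  exists G, #|edges G| = m /\
    alpha1 G + tau1 G <= k + (m %/ k).+1 + 'C(k, 2).
Proof.
move=> k0 km; set N := (m - 'C(k, 2)) %/ k; set r := (m - 'C(k, 2)) %% k.
have rk : r < k by rewrite ltn_mod.
pose d j := if j < k then j else if j < k + N then k else r.
have d1 j : d j <= j by rewrite /d; case: ltnP => // kj; case: ifP => _ //; lia.
have d2 j : d j <= k by rewrite /d; case: ltnP => [/ltnW//|_]; case: ifP => _ //; lia.
have d3 j : j < k -> d j = j by rewrite /d => ->.
exists (@back_graph (k + N).+1 d d1); split; last first.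
  apply: leq_add; last exact: tau1_back_graph.
  apply: leq_trans (alpha1_back_graph _ d1 d2 d3) _.
  by rewrite -addnS leq_add2l ltnS leq_div2r // leq_subr.
rewrite card_back_edges big_ord_recr big_split_ord /=.
under eq_bigr => i _ do rewrite d3 ?ltn_ord //.
under [X in _ + X + _]eq_bigr => i _.
  rewrite /d ltnNge leq_addr /= ltn_add2l ltn_ord.
  over.
rewrite sum_nat_const card_ord -(big_mkord xpredT id) bin2_sum.
rewrite /d ltnNge leq_addr ltnn -addnA /= -[X in _ + X]divn_eq.
exact: subnKC.
Qed.

(** * Optimising the number of colours *)

Local Open Scope classical_set_scope.
Local Open Scope ring_scope.

Section RealEstimates.
Variable R : realType.
Implicit Types (m : nat) (x : R).

Lemma two_bin2_real (k : nat) : (0 < k)%N ->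
  2 * ('C(k, 2))%:R = k%:R * (k%:R - 1) :> R.
Proof.
case: k => // k _; rewrite -[2]/(2%:R) -natrM two_bin2 natrM /=.
by congr (_ * _); rewrite -[in RHS]addn1 natrD addrK.
Qed.

(** Eliminating [t] gives S * k >= x^3 + k (k - 1)^2 / 2. For [k <= 3 * x] the
    identity k^3 + 2 x^3 - 3 x^2 k = (k - x)^2 (k + 2 x) concludes, the terms of
    lower order costing at most 3 x; for larger [k] the term k (k - 1)^2 / 2 is
    already big enough. *)
Lemma lower_estimate (x k t S : R) : 1 <= x -> 1 <= k ->
  k * (k - 1) <= 2 * t -> x ^+ 3 + t * k <= S * k + t ->
  3 / 2 * x ^+ 2 - 3 * x <= S.
Proof.
move=> x1 k1 kt h.
have k0 : 0 < k by lra.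
rewrite -(ler_pM2r k0).
have h1 : x ^+ 3 + k * (k - 1) ^+ 2 / 2 <= S * k.
  have : 0 <= (2 * t - k * (k - 1)) * (k - 1) by apply: mulr_ge0; lra.
  lra.
apply: le_trans h1; have [k3|k3] := lerP k (3 * x).
  have : 0 <= (k - x) ^+ 2 * (k + 2 * x) by rewrite mulr_ge0 ?sqr_ge0 //; lra.
  have : 0 <= k * (3 * x - k) by rewrite mulr_ge0 //; lra.
  lra.
have h2 : 3 * x ^+ 2 - 6 * x <= (k - 1) ^+ 2.
  have : 0 <= (k - 1 - 2 * x) * (k - 1 + 2 * x) by apply: mulr_ge0; lra.
  have : 0 <= x ^+ 2 by apply: sqr_ge0.
  lra.
have : 0 <= k * ((k - 1) ^+ 2 - (3 * x ^+ 2 - 6 * x)) by rewrite mulr_ge0 //; lra.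
have : 0 <= x ^+ 3 by apply: exprn_ge0; lra.
lra.
Qed.

Lemma upper_estimate (x k q : R) : 0 < x -> x <= k -> k <= x + 1 ->
  q * k <= x ^+ 3 ->
  k + (q + 1) + k * (k - 1) / 2 <= 3 / 2 * x ^+ 2 + 3 / 2 * x + 2.
Proof.
move=> x0 xk kx qk.
have q1 : q <= x ^+ 2.
  rewrite -(ler_pM2r x0).
  have [q0|q0] := lerP q 0.
    by rewrite (@le_trans _ _ 0) ?mulr_le0_ge0 ?mulr_ge0 ?sqr_ge0 ?(ltW x0).
  have : 0 <= q * (k - x) by apply: mulr_ge0; lra.
  lra.
have : 0 <= (x + 1 - k) * (x + 1 + k) by apply: mulr_ge0; lra.
lra.
Qed.

Lemma alpha1_tau1_lower G x : 1 <= x -> x ^+ 3 = #|edges G|%:R ->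
  3 / 2 * x ^+ 2 - 3 * x <= (alpha1 G + tau1 G)%:R.
Proof.
move=> x1 xm.
have E0 : (0 < #|edges G|)%N.
  by rewrite -(ltr_nat R) -xm exprn_gt0 // (lt_le_trans _ x1).
have [k [t [k0 kt h]]] := alpha1_tau1_ge E0.
apply: (@lower_estimate x k%:R t%:R) => //; first by rewrite ler1n.
  by rewrite -two_bin2_real // ler_pM2l // ler_nat.
by rewrite xm -!natrM -!natrD ler_nat.
Qed.

(** The clique size is the integer in the interval (x, x + 1], the optimal real
    value being [x]. *)
Lemma exists_alpha1_tau1_upper m x : 1 <= x -> x ^+ 3 = m%:R ->
  exists G, #|edges G| = m /\
    (alpha1 G + tau1 G)%:R <= 3 / 2 * x ^+ 2 + 3 / 2 * x + 2.
Proof.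
move=> x1 xm; have x0 : 0 < x by lra.
pose k := (Num.truncn x).+1.
have /andP[kx xk] := truncn_itv (ltW x0).
have {}kx : k%:R <= x + 1 by rewrite -natr1 lerD2r.
have kk := @two_bin2_real k isT.
have xx : x <= x ^+ 2 by rewrite ler_eXnr.
have xxx : x ^+ 2 <= x ^+ 3 by rewrite ler_weXn2l.
have km : ('C(k, 2) <= m)%N.
  rewrite -(ler_nat R) -xm.
  have : 0 <= (x + 1 - k%:R) * (x + k%:R) by rewrite mulr_ge0 // ?subr_ge0 // addr_ge0 // ltW.
  lra.
have [G [Gm GS]] := @exists_small_graph m k isT km; exists G; split => //.
apply: (@le_trans _ _ (k%:R + ((m %/ k)%:R + 1) + k%:R * (k%:R - 1) / 2)).
  rewrite -kk mulrAC divff ?mul1r ?pnatr_eq0 // natr1 -!natrD ler_nat.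
  exact: GS.
by apply: upper_estimate; rewrite ?(ltW xk) // xm -natrM ler_nat leq_divM.
Qed.

(** The errors in the two bounds on alpha1 + tau1 are 3 x and 3/2 x + 2, both at
    most 5 x; dividing by m^(2/3) = x^2 leaves 5 / x. *)
Lemma min_ratio_near m x : 1 <= x -> x ^+ 3 = m%:R ->
  `|3 / 2 - min_ratio R m| <= 5 / x.
Proof.
move=> x1 xm; have x0 : 0 < x by lra.
have x2 : m%:R `^ (2 / 3) = x ^+ 2 :> R.
  rewrite -xm -[x ^+ 3]powR_mulrn ?(ltW x0) // -powRrM.
  by rewrite mulrCA divff ?pnatr_eq0 // mulr1 powR_mulrn // ltW.
have x20 : 0 < x ^+ 2 by rewrite exprn_gt0.
have [[G [Gm Gr]] minG] := min_ratioP R m.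
have lo : 3 / 2 - 5 / x <= min_ratio R m.
  rewrite Gr /Defs.ratio x2 ler_pdivlMr //.
  have -> : (3 / 2 - 5 / x) * x ^+ 2 = 3 / 2 * x ^+ 2 - 5 * x.
    by field; rewrite gt_eqF.
  have := @alpha1_tau1_lower G x x1; rewrite Gm => /(_ xm); lra.
have hi : min_ratio R m <= 3 / 2 + 5 / x.
  have [H [Hm HS]] := exists_alpha1_tau1_upper x1 xm.
  apply: (@le_trans _ _ (Defs.ratio R H m)); first by apply: minG; exists H.
  rewrite /Defs.ratio x2 ler_pdivrMr //.
  have -> : (3 / 2 + 5 / x) * x ^+ 2 = 3 / 2 * x ^+ 2 + 5 * x.
    by field; rewrite gt_eqF.
  lra.
by rewrite ler_norml; apply/andP; split; lra.
Qed.

End RealEstimates.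

Unset Implicit Arguments.

Theorem theorem1p2 (R : realType) :
  min_ratio R m @[m --> \oo] --> (3 / 2 : R).
Proof.
apply/cvgrPdist_le => /= e e0.
(* [5 / x <= e] as soon as [x >= 5 / e]. *)
pose y : R := Num.max 1 (5 / e).
have y1 : 1 <= y by rewrite le_max lexx.
have y0 : 0 < y by apply: lt_le_trans y1.
near=> m.
have ym : y ^+ 3 <= m%:R by near: m; exact: nbhs_infty_ger.
have x3 : (m%:R `^ 3^-1) ^+ 3 = m%:R :> R.
  by rewrite -powR_mulrn ?powR_ge0 // -powRrM mulVf ?pnatr_eq0 // powRr1.
have yx : y <= m%:R `^ 3^-1.
  by rewrite -(@ler_pXn2r _ 3) ?x3 // nnegrE ?powR_ge0 // ltW.
have x1 := le_trans y1 yx.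
apply: le_trans (min_ratio_near x1 x3) _.
rewrite ler_pdivrMr ?(lt_le_trans y0) // mulrC -ler_pdivrMr //.
by apply: le_trans yx; rewrite le_max lexx orbT.
Unshelve. all: by end_near.
Qed.
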